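(* Let $\mathbf{X},\mathbf{Y}$ be quasivarieties and let $\langle\zeta,f\rangle:Tm(\mathcal{L}_{\mathbf{X}})\to Tm(\mathcal{L}_{\mathbf{Y}})$ be a sober translation. Then the assignment $\tau:\Xi(\mathbf{X})\to\Xi^f(\mathbf{Y})$, $\tau(\mathbf{K})=\{\mathcal{A}\in\mathbf{Y}:\theta(\mathcal{A})\in\mathbf{K}\}$, is a lattice isomorphism.
   Context: A quasivariety is a class of similar algebras closed under isomorphisms, subalgebras and reduced products. $\mathbf{X},\mathbf{Y}$ have languages $\mathcal{L}_{\mathbf{X}},\mathcal{L}_{\mathbf{Y}}$; $\Xi(\mathbf{K})$ is the lattice of subquasivarieties of $\mathbf{K}$. For a class $\mathbf{K}$, $\Phi\vDash_{\mathbf{K}}\lambda\approx\gamma$ means every assignment into an algebra of $\mathbf{K}$ satisfying $\Phi$ satisfies $\lambda\approx\gamma$. Selective translation: $\zeta$ assigns to each $n$-ary symbol $g\in\mathcal{L}_{\mathbf{X}}$ an $n$-ary term $\zeta(g)$ of $\mathcal{L}_{\mathbf{Y}}$; $f(x)$ is a unary term of $\mathcal{L}_{\mathbf{Y}}$ (the selector). For an infinite variable set $V$ define $\zeta_*:Tm(\mathcal{L}_{\mathbf{X}},V)\to Tm(\mathcal{L}_{\mathbf{Y}},V)$ by $\zeta_*(x)=f(x)$ on variables and $\zeta_*(g(\phi_1,\dots,\phi_n))=\zeta(g)(\zeta_*(\phi_1),\dots,\zeta_*(\phi_n))$ (in particular $\zeta_*(c)=\zeta(c)$ for constants), and $\zeta^*(\Phi)=\{\zeta_*(\delta)\approx\zeta_*(\gamma):\delta\approx\gamma\in\Phi\}$.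 $\langle\zeta,f\rangle$ is a selective translation if: (i) $\vDash_{\mathbf{Y}}f(f(x))\approx f(x)$; (ii) $\Phi\vDash_{\mathbf{X}}\lambda\approx\gamma$ implies $\zeta^*(\Phi)\cup\{f(x)\approx x:x\in V\}\vDash_{\mathbf{Y}}\zeta^*(\lambda\approx\gamma)$; (iii) for each $n$-ary $g\in\mathcal{L}_{\mathbf{X}}$, $\{f(x_i)\approx x_i:i\le n\}\vDash_{\mathbf{Y}}f(\zeta(g)(x_1,\dots,x_n))\approx\zeta(g)(x_1,\dots,x_n)$. For $\mathcal{A}\in\mathbf{Y}$, $\mathcal{A}^f=\{a\in A:f(a)=a\}$, and $\theta(\mathcal{A})\in\mathbf{X}$ is the algebra with universe $\mathcal{A}^f$ and operations $g^{\theta(\mathcal{A})}=\zeta(g)^{\mathcal{A}}$ restricted to $\mathcal{A}^f$. With restriction on homomorphisms, $\theta:\mathbf{Y}\to\mathbf{X}$ is a right adjoint functor; $\mathcal{F}:\mathbf{X}\to\mathbf{Y}$ is its left adjoint, with unit $\eta:1\Rightarrow\theta\mathcal{F}$ and counit $\varepsilon:\mathcal{F}\theta\Rightarrow1$. A selective translation is strongly selective if $\eta$ is an isomorphism, and sober if moreover $\varepsilon$ is pointwise injective and $\mathcal{F}$ preserves injective homomorphisms. For $\mathcal{A},\mathcal{B}\in\mathbf{Y}$, $\mathcal{B}\preceq_f\mathcal{A}$ means $\mathcal{B}$ is a subalgebra of $\mathcal{A}$ with $\mathcal{B}^f=\mathcal{A}^f$; for $\mathbf{K}\in\Xi(\mathbf{Y})$,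 $\mathbf{K}^\uparrow=\{\mathcal{A}\in\mathbf{Y}:\exists\mathcal{B}\in\mathbf{K},\ \mathcal{B}\preceq_f\mathcal{A}\}$; $\Xi^f(\mathbf{Y})=\{\mathbf{K}^\uparrow:\mathbf{K}\in\Xi(\mathbf{Y})\}$ is the complete lattice (under inclusion) of $\mathsf{PAt}$-$f$-quasivarieties. *)

(* Defs.v *)
From Stdlib Require List.
From HB Require Import structures.
From mathcomp Require Import all_boot all_order.
From mathcomp Require Import boolp classical_sets functions cardinality filter.

Set Implicit Arguments.
Unset Strict Implicit.
Unset Printing Implicit Defensive.

Import Order.TTheory.
Local Open Scope classical_set_scope.
Local Open Scope order_scope.

(* A copy of ['I_n] living in [Set].  The sort of ['I_n] is the universe of
   eqTypes, which would propagate to terms, then to carriers, and would prevent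
   classes of algebras from forming the eqTypes [Xi] and [Xif] below. *)
Definition fin (n : nat) : Set := {i : nat | (i < n)%N}.

Definition fin_of_ord (n : nat) (i : 'I_n) : fin n := exist _ (val i) (ltn_ord i).
Definition ord_of_fin (n : nat) (i : fin n) : 'I_n := Ordinal (svalP i).

Lemma ord_of_finK (n : nat) : cancel (@ord_of_fin n) (@fin_of_ord n).
Proof. by case=> i hi; apply: eq_exist. Qed.

Record signature := Signature {
  sym : Type;
  arity : sym -> nat }.

Record algebra (L : signature) := Algebra {
  carrier :> Type;
  op : forall g : sym L, (fin (arity g) -> carrier) -> carrier;
  carrier_inhabited : inhabited carrier }.
Arguments op {L a} g.

Record hom (L : signature) (A B : algebra L) := MkHom {
  hom_fun :> A -> B;
  hom_op : forall (g : sym L) (x : fin (arity g) -> A),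
    hom_fun (op g x) = op g (fun i => hom_fun (x i)) }.

Lemma hom_ext (L : signature) (A B : algebra L) (h k : hom A B) :
  (forall x, h x = k x) -> h = k.
Proof.
case: h k => [h hP] [k kP] /= /funext hk; case: _ / hk in kP *.
by congr MkHom.
Qed.

Definition hom_id (L : signature) (A : algebra L) : hom A A :=
  @MkHom L A A (fun x => x) (fun g x => erefl).

Definition hom_comp (L : signature) (A B C : algebra L)
    (k : hom B C) (h : hom A B) : hom A C :=
  @MkHom L A C (fun x => k (h x))
    (fun g x => etrans (congr1 k (hom_op h x)) (hom_op k _)).

Lemma hom_comp_idl (L : signature) (A B : algebra L) (h : hom A B) :
  hom_comp (hom_id B) h = h.
Proof. exact: hom_ext. Qed.

Lemma hom_comp_idr (L : signature) (A B : algebra L) (h : hom A B) :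
  hom_comp h (hom_id A) = h.
Proof. exact: hom_ext. Qed.

Lemma hom_compA (L : signature) (A B C D : algebra L)
    (w : hom C D) (v : hom B C) (u : hom A B) :
  hom_comp w (hom_comp v u) = hom_comp (hom_comp w v) u.
Proof. exact: hom_ext. Qed.

Definition isomorphic (L : signature) (A B : algebra L) : Prop :=
  exists h : hom A B, bijective h.

Record subuniverse (L : signature) (A : algebra L) (S : set A) : Prop :=
  Subuniverse {
  subuniverse_nonempty : S !=set0;
  subuniverse_op : forall (g : sym L) (x : fin (arity g) -> A),
    (forall i, S (x i)) -> S (op g x) }.

Definition subalgebra (L : signature) (A : algebra L) (S : set A)
    (hS : subuniverse S) : algebra L :=
  @Algebra L {a : A | S a}
    (fun g x => exist _ (op g (fun i => sval (x i)))
                  (subuniverse_op hS (fun i => svalP (x i))))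
    (let: ex_intro a Sa := subuniverse_nonempty hS in inhabits (exist _ a Sa)).

Section ReducedProduct.
Variables (L : signature) (I : Type) (F : set_system I) (FF : Filter F).
Variable A : I -> algebra L.

(* [_ -> Prop] rather than [set _]: the latter would put the carriers of
   algebras and the classes of algebras in conflicting universes *)
Definition filter_class (a : forall i, A i) : (forall i, A i) -> Prop :=
  fun b => F [set i | a i = b i].

(* the quotient of the direct product by equality modulo [F], realised as the
   type of equivalence classes *)
Definition rprod_carrier : Type :=
  {S : (forall i, A i) -> Prop | exists a, S = filter_class a}.

Definition rprod_proj (a : forall i, A i) : rprod_carrier :=
  exist _ (filter_class a) (ex_intro _ a erefl).

Definition rprod_repr (x : rprod_carrier) : forall i, A i :=
  sval (cid (svalP x)).

Definition rprod_op (g : sym L) (x : fin (arity g) -> rprod_carrier) :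
    rprod_carrier :=
  rprod_proj (fun i => op g (fun k => rprod_repr (x k) i)).

Lemma rprod_inhabited : inhabited rprod_carrier.
Proof.
have h i : exists a : A i, True by have [a] := carrier_inhabited (A i); exists a.
by constructor; apply: rprod_proj => i; exact: sval (cid (h i)).
Qed.

Definition reduced_product : algebra L :=
  @Algebra L rprod_carrier rprod_op rprod_inhabited.

Lemma rprod_projE (a b : forall i, A i) :
  rprod_proj a = rprod_proj b <-> F [set i | a i = b i].
Proof.
split=> [/(congr1 sval)/= e|Fab].
  suff: filter_class a b by [].
  rewrite e /filter_class /=.
  by apply: filterS filterT => i _.
apply: eq_exist; apply/(@seteqP _ (filter_class a)); split=> c /= h.
  by apply: filterS2 Fab h => i /= <- ->.
by apply: filterS2 Fab h => i /= -> ->.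
Qed.

Lemma rprod_reprK (x : rprod_carrier) : rprod_proj (rprod_repr x) = x.
Proof.
by case: x => S hS; apply: eq_exist; rewrite /rprod_repr /=; case: cid.
Qed.

(* the operations are induced by those of the direct product *)
Lemma rprod_op_proj (g : sym L) (a : fin (arity g) -> forall i, A i) :
  @op L reduced_product g (fun k => rprod_proj (a k)) =
  rprod_proj (fun i => op g (fun k => a k i)).
Proof.
apply/rprod_projE.
have H : F [set i | forall k, rprod_repr (rprod_proj (a k)) i = a k i].
  have H : F [set i | forall k : 'I_(arity g),
      rprod_repr (rprod_proj (a (fin_of_ord k))) i = a (fin_of_ord k) i].
    by apply: filter_forall => k; apply/rprod_projE; rewrite rprod_reprK.
  by apply: filterS H => i h k; rewrite -(ord_of_finK k).
by apply: filterS H => i /= h; congr op; apply/funext.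
Qed.

End ReducedProduct.

(* The index type of a reduced product may be empty and the filter may be
   improper, so a quasivariety contains the one-element algebras. *)
Record is_quasivariety (L : signature) (K : algebra L -> Prop) : Prop :=
  IsQuasivariety {
  quasi_iso : forall A B : algebra L, isomorphic A B -> K A -> K B;
  quasi_sub : forall (A : algebra L) (S : set A) (hS : subuniverse S),
    K A -> K (subalgebra hS);
  quasi_rprod : forall (I : Type) (F : set_system I) (A : I -> algebra L),
    Filter F -> (forall i, K (A i)) -> K (reduced_product F A) }.

Record quasivariety (L : signature) := Quasivariety {
  qclass :> algebra L -> Prop;
  qclassP : is_quasivariety qclass }.

Lemma quasi_inj (L : signature) (K : algebra L -> Prop) (A B : algebra L)
    (h : hom A B) :
  is_quasivariety K -> injective h -> K B -> K A.
Proof.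
move=> qK hI KB.
have hS : subuniverse (range h).
  split; first by have [a] := carrier_inhabited A; exists (h a), a.
  move=> g x xS; have xS' k : exists a, h a = x k by have [a _] := xS k; exists a.
  have [y yP] := choice xS'.
  by exists (op g y) => //; rewrite hom_op; congr op; apply/funext.
apply: (quasi_iso qK) (quasi_sub qK hS KB).
have gx (x : subalgebra hS) : exists a, h a = sval x.
  by case: x => _ /= [a _ <-]; exists a.
have [k kP] := choice gx.
have kop (g : sym L) (x : fin (arity g) -> subalgebra hS) :
    k (op g x) = op g (fun i => k (x i)).
  apply: hI; rewrite kP hom_op.
  by under [in RHS]eq_fun do rewrite kP.
exists (MkHom kop).
exists (fun a => exist _ (h a) (imageT h a)) => x /=.
  by case: x => S hx; apply: eq_exist; rewrite kP.
by apply: hI; rewrite kP.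
Qed.

Inductive term (L : signature) (V : Type) : Type :=
| Var of V
| App (g : sym L) of (fin (arity g) -> term L V).
Arguments Var {L V}.
Arguments App {L V}.

(* an n-ary term has its variables x_1, ..., x_n indexed by [fin n] *)
Notation nary_term L n := (term L (fin n)).

Fixpoint eval (L : signature) (V : Type) (A : algebra L) (v : V -> A)
    (t : term L V) : A :=
  match t with
  | Var x => v x
  | App g ts => op g (fun i => eval v (ts i))
  end.

Fixpoint subst (L : signature) (V W : Type) (s : V -> term L W)
    (t : term L V) : term L W :=
  match t with
  | Var x => s x
  | App g ts => App g (fun i => subst s (ts i))
  end.

Notation equation L V := (term L V * term L V)%type.

Definition satisfies (L : signature) (V : Type) (A : algebra L) (v : V -> A)
    (e : equation L V) : Prop :=
  eval v e.1 = eval v e.2.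

Definition consequence (L : signature) (V : Type) (K : algebra L -> Prop)
    (Phi : set (equation L V)) (e : equation L V) : Prop :=
  forall A : algebra L, K A -> forall v : V -> A,
    (forall d, Phi d -> satisfies v d) -> satisfies v e.

Lemma eval_subst (L : signature) (V W : Type) (A : algebra L) (v : W -> A)
    (s : V -> term L W) (t : term L V) :
  eval v (subst s t) = eval (fun x => eval v (s x)) t.
Proof. by elim: t => //= g ts IH; congr op; apply/funext. Qed.

Lemma eval_hom (L : signature) (V : Type) (A B : algebra L) (h : hom A B)
    (v : V -> A) (t : term L V) :
  h (eval v t) = eval (fun x => h (v x)) t.
Proof. by elim: t => //= g ts IH; rewrite hom_op; congr op; apply/funext. Qed.

Record var_set := VarSet {
  vars :> Type;
  vars_infinite : infinite_set [set: vars] }.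

Section Translation.
Variables (LX LY : signature).
Variables (zeta : forall g : sym LX, nary_term LY (arity g)).
Variables (f : nary_term LY 1).

Definition sel_term (V : Type) (t : term LY V) : term LY V :=
  subst (fun _ => t) f.

Fixpoint zeta_term (V : Type) (t : term LX V) : term LY V :=
  match t with
  | Var x => sel_term (Var x)
  | App g ts => subst (fun i => zeta_term (ts i)) (zeta g)
  end.

Definition zeta_eq (V : Type) (e : equation LX V) : equation LY V :=
  (zeta_term e.1, zeta_term e.2).

Definition sel_eqs (V : Type) : set (equation LY V) :=
  [set (sel_term (Var x), Var x) | x in [set: V]].

End Translation.
Arguments zeta_eq {LX LY} zeta f {V} e.
Arguments sel_eqs {LY} f V _.

Record selective_translation (LX LY : signature) (X : quasivariety LX)
    (Y : quasivariety LY) (V : var_set) := SelectiveTranslation {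
  zeta : forall g : sym LX, nary_term LY (arity g);
  sel : nary_term LY 1;
  sel_idem : forall x : V,
    consequence Y set0 (sel_term sel (sel_term sel (Var x)), sel_term sel (Var x));
  zeta_consequence : forall (Phi : set (equation LX V)) (e : equation LX V),
    consequence X Phi e ->
    consequence Y (zeta_eq zeta sel @` Phi `|` sel_eqs sel V) (zeta_eq zeta sel e);
  zeta_sel : forall g : sym LX,
    consequence Y (sel_eqs sel (fin (arity g))) (sel_term sel (zeta g), zeta g) }.

Definition sel_op (LY : signature) (f : nary_term LY 1) (A : algebra LY) (a : A) : A :=
  eval (fun _ => a) f.

Definition fixed (LY : signature) (f : nary_term LY 1) (A : algebra LY) : set A :=
  [set a | sel_op f a = a].
Arguments fixed {LY} f A.

Lemma fixed_hom (LY : signature) (f : nary_term LY 1) (A B : algebra LY)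
    (h : hom A B) (a : A) : fixed f A a -> fixed f B (h a).
Proof. by rewrite /fixed /sel_op /= -eval_hom => ->. Qed.

Lemma eval_support (L : signature) (V : Type) (t : term L V) :
  exists s : seq {classic V}, forall (A : algebra L) (v w : V -> A),
    (forall x, x \in s -> v x = w x) -> eval v t = eval w t.
Proof.
elim: t => [x|g ts /choice[s sP]].
  by exists [:: x] => A v w; apply; rewrite inE.
exists (flatten [seq s (fin_of_ord i) | i <- enum 'I_(arity g)]) => A v w vw /=.
congr op; apply/funext => i; apply: sP => x xs; apply: vw.
apply/flatten_mapP; exists (ord_of_fin i); first by rewrite mem_enum.
by rewrite ord_of_finK.
Qed.

Lemma eq_support (L : signature) (V : Type) (l : seq (equation L V)) :
  exists s : seq {classic V}, forall (A : algebra L) (v w : V -> A),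
    (forall x, x \in s -> v x = w x) ->
    forall d, List.In d l -> satisfies v d <-> satisfies w d.
Proof.
elim: l => [|[t u] l [s sP]]; first by exists [::].
have [st stP] := eval_support t; have [su suP] := eval_support u.
exists (st ++ su ++ s) => A v w vw d /= [<-|dl].
  rewrite /satisfies /= (stP A v w) ?(suP A v w)// => x xs; apply: vw.
    by rewrite !mem_cat xs orbT.
  by rewrite !mem_cat xs.
by apply: sP => // x xs; apply: vw; rewrite !mem_cat xs !orbT.
Qed.

Lemma infinite_inj (V : Type) : infinite_set [set: V] ->
  exists j : nat -> V, injective j.
Proof.
move=> /infiniteP/card_leP[f].
exists (fun n => val (f (SigSub (mem_set (I : [set: nat] n))))) => m n /val_inj.
by move=> /(inj (in_setT _) (in_setT _))/(congr1 val).
Qed.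

(* an algebra satisfying all implications valid in a quasivariety belongs to it *)
Lemma quasivariety_axioms (L : signature) (X : quasivariety L) (V : var_set)
    (B : algebra L) :
  (forall (Phi : set (equation L V)) (e : equation L V), consequence X Phi e ->
     forall v : V -> B, (forall d, Phi d -> satisfies v d) -> satisfies v e) ->
  X B.
Proof.
move=> HB.
have [j jI] := infinite_inj (@vars_infinite V).
have HB' : forall (l : seq (equation L B)) (e : equation L B),
    consequence X [set d | List.In d l] e ->
    (forall d, List.In d l -> satisfies id d) -> satisfies (A := B) id e.
  move=> l e le lB.
  have [s sP] := eq_support (e :: l).
  pose rho (b : {classic B}) : V := j (index b s).
  have [b0] := carrier_inhabited B.
  pose sigma (u : V) : B :=
    if pselect (exists b : {classic B}, b \in s /\ rho b = u) is left h
    then sval (cid h) else b0.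
  have sigmaK (b : {classic B}) : b \in s -> sigma (rho b) = b.
    move=> bs; rewrite /sigma; case: pselect => [h|[]]; last by exists b.
    case: cid => c /= [cs] /jI; apply: (@index_inj _ c s) => //.
  pose ren (t : term L B) : term L V := subst (fun b => Var (rho b)) t.
  pose ren_eq (d : equation L B) : equation L V := (ren d.1, ren d.2).
  have renE (C : algebra L) (v : V -> C) (d : equation L B) :
      satisfies v (ren_eq d) <-> satisfies (fun b => v (rho b)) d.
    by rewrite /satisfies /ren_eq /ren !eval_subst.
  have key (d : equation L B) : List.In d (e :: l) ->
      satisfies sigma (ren_eq d) <-> satisfies (A := B) id d.
    by move=> dl; rewrite renE; apply: sP dl => x xs; rewrite sigmaK.
  apply/key; first by left.
  apply: (HB [set ren_eq d | d in [set d | List.In d l]]).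
    move=> A XA v vP; apply/renE; apply: le => // d dl.
    by apply/renE; apply: vP; exists d.
  by move=> _ [d dl <-]; apply/key; [right|exact: lB].
pose I : Type := ({l : seq (equation L B) |
                    forall d, List.In d l -> satisfies (A := B) id d} *
                  {e : equation L B | ~ satisfies (A := B) id e})%type.
have hI (i : I) : exists Cv : {C : algebra L & B -> C},
    [/\ X (projT1 Cv),
        forall d, List.In d (sval i.1) -> satisfies (projT2 Cv) d &
        ~ satisfies (projT2 Cv) (sval i.2)].
  case: i => [[l lB] [e eB]] /=; apply: contrapT => nC; apply: eB.
  apply: (HB' l) => // A XA v vP; apply: contrapT => ve.
  by apply: nC; exists (existT _ A v).
have [Cv CvP] := choice hI.
pose C i := projT1 (Cv i).
pose v i : B -> C i := projT2 (Cv i).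
pose F : set_system I := [set S | exists2 l : seq (equation L B),
  (forall d, List.In d l -> satisfies (A := B) id d) &
  forall i : I, (forall d, List.In d l -> List.In d (sval i.1)) -> S i].
have FF : Filter F.
  split.
  - by exists [::].
  - move=> S T [l lB lS] [m mB mT]; exists (l ++ m).
      by move=> d /List.in_app_iff[/lB|/mB].
    move=> i lm; split; [apply: lS|apply: mT] => d dl; apply: lm;
      apply/List.in_app_iff; by [left|right].
  - by move=> S T ST [l lB lS]; exists l => // i /lS/ST.
have XP : X (reduced_product F C).
  by apply: (quasi_rprod (qclassP X)) => i; have [] := CvP i.
pose h (b : B) : reduced_product F C := rprod_proj F (fun i => v i b).
have hP (g : sym L) (x : fin (arity g) -> B) : h (op g x) = op g (fun k => h (x k)).
  rewrite rprod_op_proj; apply/rprod_projE.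
  pose d : equation L B := (Var (op g x), App g (fun k => Var (x k))).
  exists [:: d] => [_ [<-|]//|i /(_ d)/= dP].
  have [_ /(_ d) + _] := CvP i; apply.
  by apply: dP; left.
have hI' : injective h.
  move=> b c /rprod_projE[l lB lS]; apply: contrapT => nbc.
  pose e : equation L B := (Var b, Var c).
  have := lS (exist _ l lB, exist _ e nbc) (fun _ => id).
  by have [_ _] := CvP (exist _ l lB, exist _ e nbc).
exact: (quasi_inj (qclassP X) (h := MkHom hP) hI' XP).
Qed.

Section Theta.
Variables (LX LY : signature) (X : quasivariety LX) (Y : quasivariety LY).
Variables (V : var_set) (T : selective_translation X Y V).

Lemma eval_sel_term (W : Type) (A : algebra LY) (v : W -> A) (t : term LY W) :
  eval v (sel_term (sel T) t) = sel_op (sel T) (eval v t).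
Proof. exact: eval_subst. Qed.

Lemma fixed_sel_op (A : algebra LY) (a : A) :
  Y A -> fixed (sel T) A (sel_op (sel T) a).
Proof.
move=> YA; have [x _] : [set: V] !=set0 by apply/infinite_setN0/vars_infinite.
have := sel_idem T x YA (v := fun _ => a).
by rewrite /satisfies /= !eval_sel_term; apply.
Qed.

Lemma fixed_zeta (A : algebra LY) (g : sym LX) (a : fin (arity g) -> A) :
  Y A -> (forall i, fixed (sel T) A (a i)) -> fixed (sel T) A (eval a (zeta T g)).
Proof.
move=> YA af; have := @zeta_sel _ _ _ _ _ T g A YA a.
rewrite /satisfies /= eval_sel_term; apply.
by move=> _ [i _ <-]; rewrite /satisfies /= eval_sel_term; exact: af.
Qed.

Lemma fixed_inhabited (A : algebra LY) : Y A -> inhabited {a : A | fixed (sel T) A a}.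
Proof.
move=> YA; have [a] := carrier_inhabited A.
by constructor; exists (sel_op (sel T) a); exact: fixed_sel_op.
Qed.

Definition theta_algebra (A : algebra LY) (hA : Y A) : algebra LX :=
  @Algebra LX {a : A | fixed (sel T) A a}
    (fun g x => exist _ (eval (fun i => sval (x i)) (zeta T g))
                  (fixed_zeta hA (fun i => svalP (x i))))
    (fixed_inhabited hA).

Lemma eval_theta (A : algebra LY) (hA : Y A) (W : Type) (v : W -> theta_algebra hA)
    (t : term LX W) :
  sval (eval v t) = eval (fun x => sval (v x)) (zeta_term (zeta T) (sel T) t).
Proof.
elim: t => [x|g ts IH] /=.
  by rewrite eval_sel_term /=; case: (v x).
by rewrite eval_subst; congr eval; apply/funext.
Qed.

Lemma theta_mem (A : algebra LY) (hA : Y A) : X (theta_algebra hA).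
Proof.
apply: (quasivariety_axioms (V := V)) => Phi e Phie v vPhi.
have E (d : equation LX V) : satisfies v d <->
    satisfies (fun x => sval (v x)) (zeta_eq (zeta T) (sel T) d).
  rewrite /satisfies /zeta_eq /= -!eval_theta; split=> [->//|].
  by case: (eval v d.1) (eval v d.2) => a a' [b b'] /= ab; apply: eq_exist.
apply/E; apply: (zeta_consequence (s := T) Phie) => // _ [[d Pd <-]|[x _ <-]].
  exact/E/vPhi.
by rewrite /satisfies /= eval_sel_term /=; case: (v x).
Qed.

End Theta.

Record category := Category {
  ob :> Type;
  mor : ob -> ob -> Type;
  idm : forall a, mor a a;
  cmp : forall a b c, mor b c -> mor a b -> mor a c;
  cmp_idl : forall a b (u : mor a b), cmp (idm b) u = u;
  cmp_idr : forall a b (u : mor a b), cmp u (idm a) = u;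
  cmp_assoc : forall a b c d (w : mor c d) (v : mor b c) (u : mor a b),
    cmp w (cmp v u) = cmp (cmp w v) u }.

Definition is_iso (C : category) (a b : C) (u : mor a b) : Prop :=
  exists v : mor b a, cmp v u = idm a /\ cmp u v = idm b.

Record functor (C D : category) := Functor {
  fob :> C -> D;
  fmap : forall a b : C, mor a b -> mor (fob a) (fob b);
  fmap_id : forall a : C, fmap (idm a) = idm (fob a);
  fmap_cmp : forall (a b c : C) (v : mor b c) (u : mor a b),
    fmap (cmp v u) = cmp (fmap v) (fmap u) }.

Record left_adjoint (C D : category) (G : functor D C) := LeftAdjoint {
  ladj :> functor C D;
  unit : forall c : C, mor c (G (ladj c));
  counit : forall d : D, mor (ladj (G d)) d;
  unit_natural : forall (a b : C) (u : mor a b),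
    cmp (fmap G (fmap ladj u)) (unit a) = cmp (unit b) u;
  counit_natural : forall (a b : D) (u : mor a b),
    cmp u (counit a) = cmp (counit b) (fmap ladj (fmap G u));
  triangle_left : forall c : C,
    cmp (counit (ladj c)) (fmap ladj (unit c)) = idm (ladj c);
  triangle_right : forall d : D,
    cmp (fmap G (counit d)) (unit (G d)) = idm (G d) }.

(* the full subcategory of algebras belonging to [K] *)
Definition qcat (L : signature) (K : quasivariety L) : category :=
  @Category {A : algebra L | K A} (fun A B => hom (sval A) (sval B))
    (fun A => hom_id (sval A)) (fun A B C k h => hom_comp k h)
    (fun A B h => hom_comp_idl h) (fun A B h => hom_comp_idr h)
    (fun A B C D w v u => hom_compA w v u).

Section ThetaFunctor.
Variables (LX LY : signature) (X : quasivariety LX) (Y : quasivariety LY).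
Variables (V : var_set) (T : selective_translation X Y V).

Definition theta_ob (A : qcat Y) : qcat X :=
  exist _ (theta_algebra T (svalP A)) (theta_mem T (svalP A)).

Definition theta_fun (A B : qcat Y) (h : mor A B)
    (a : sval (theta_ob A)) : sval (theta_ob B) :=
  exist _ (h (sval a)) (fixed_hom h (svalP a)).

Lemma theta_fun_op (A B : qcat Y) (h : mor A B) (g : sym LX)
    (x : fin (arity g) -> sval (theta_ob A)) :
  theta_fun h (op g x) = op g (fun i => theta_fun h (x i)).
Proof. by apply: eq_exist; rewrite /= eval_hom. Qed.

Definition theta_mor (A B : qcat Y) (h : mor A B) :
    mor (theta_ob A) (theta_ob B) :=
  MkHom (theta_fun_op h).

Lemma theta_mor_id (A : qcat Y) : theta_mor (idm A) = idm (theta_ob A).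
Proof. by apply: hom_ext => -[a ha]; apply: eq_exist. Qed.

Lemma theta_mor_cmp (A B C : qcat Y) (k : mor B C) (h : mor A B) :
  theta_mor (cmp k h) = cmp (theta_mor k) (theta_mor h).
Proof. by apply: hom_ext => -[a ha]; apply: eq_exist. Qed.

Definition theta : functor (qcat Y) (qcat X) :=
  Functor theta_mor_id theta_mor_cmp.

Definition strongly_selective (F : left_adjoint theta) : Prop :=
  forall A : qcat X, is_iso (unit F A).

(* A left adjoint is unique up to isomorphism, so the choice of [F] is
   immaterial. *)
Definition sober : Prop :=
  exists F : left_adjoint theta,
    [/\ strongly_selective F,
        forall B : qcat Y, injective (counit F B : hom _ _) &
        forall (A B : qcat X) (h : mor A B),
          injective (h : hom _ _) -> injective (fmap F h : hom _ _)].

End ThetaFunctor.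

Fact inclusion_display : Order.disp_t. Proof. exact: Order.Disp tt tt. Qed.

Record Xi (L : signature) (X : quasivariety L) := MkXi {
  xi_class :> algebra L -> Prop;
  xi_quasi : is_quasivariety xi_class;
  xi_sub : xi_class `<=` X }.

Section XiLattice.
Variables (L : signature) (X : quasivariety L).

HB.instance Definition _ := gen_eqMixin (Xi X).
HB.instance Definition _ := gen_choiceMixin (Xi X).

Lemma xi_ext (K M : Xi X) : (K : set _) = (M : set _) -> K = M.
Proof.
by case: K M => [K K1 K2] [M M1 M2] /= KM; case: _ / KM in M1 M2 *; congr MkXi.
Qed.

Definition xi_le (K M : Xi X) : bool := `[< K `<=` M >].

Lemma xi_le_refl : reflexive xi_le.
Proof. by move=> K; apply/asboolP. Qed.

Lemma xi_le_anti : antisymmetric xi_le.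
Proof. by move=> K M /andP[/asboolP KM /asboolP MK]; apply/xi_ext/seteqP. Qed.

Lemma xi_le_trans : transitive xi_le.
Proof. by move=> M K N /asboolP KM /asboolP MN; apply/asboolP => A /KM/MN. Qed.

HB.instance Definition _ :=
  Order.Le_isPOrder.Build inclusion_display (Xi X) xi_le_refl xi_le_anti xi_le_trans.

Definition xi_inf_class (P : set (Xi X)) : algebra L -> Prop :=
  fun A => X A /\ forall K : Xi X, P K -> K A.

Lemma xi_inf_quasi (P : set (Xi X)) : is_quasivariety (xi_inf_class P).
Proof.
split.
- move=> A B AB [XA PA]; split; first exact: (quasi_iso (qclassP X) AB XA).
  by move=> K PK; exact: (quasi_iso (xi_quasi K) AB (PA K PK)).
- move=> A S hS [XA PA]; split; first exact: (quasi_sub (qclassP X) hS XA).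
  by move=> K PK; exact: (quasi_sub (xi_quasi K) hS (PA K PK)).
- move=> I F A FF PA; split.
    by apply: (quasi_rprod (qclassP X) FF) => i; have [] := PA i.
  move=> K PK; apply: (quasi_rprod (xi_quasi K) FF) => i.
  by have [_] := PA i; apply.
Qed.

Definition xi_inf (P : set (Xi X)) : Xi X :=
  MkXi (xi_inf_quasi P) (fun A => @proj1 _ _).

Definition xi_meet (K M : Xi X) : Xi X := xi_inf [set K; M].
Definition xi_join (K M : Xi X) : Xi X :=
  xi_inf [set N | (K <= N) && (M <= N)].

Lemma xi_meetP (K M N : Xi X) : (K <= xi_meet M N) = (K <= M) && (K <= N).
Proof.
apply/idP/andP => [/asboolP KMN|[/asboolP KM /asboolP KN]].
  by split; apply/asboolP => A /KMN[_]; apply; [left|right].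
apply/asboolP => A KA; split; first exact: xi_sub KA.
by move=> _ [->|->]; [exact: KM|exact: KN].
Qed.

Lemma xi_joinP (K M N : Xi X) : (xi_join K M <= N) = (K <= N) && (M <= N).
Proof.
apply/idP/idP => [/asboolP KMN|KMN]; last by apply/asboolP => A [_]; apply.
apply/andP; split; apply/asboolP => A HA; apply: KMN; split;
  try exact: xi_sub HA.
  by move=> J /andP[/asboolP KJ _]; exact: KJ.
by move=> J /andP[_ /asboolP MJ]; exact: MJ.
Qed.

HB.instance Definition _ := Order.POrder_MeetJoin_isLattice.Build
  inclusion_display (Xi X) xi_meetP xi_joinP.

End XiLattice.

(* the subalgebra [B] of [A] with universe [S] satisfies [B^f = A^f] *)
Definition f_subalgebra (L : signature) (f : nary_term L 1) (A : algebra L)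
    (S : set A) (hS : subuniverse S) : Prop :=
  [set sval b | b in fixed f (subalgebra hS)] = fixed f A.

Definition upclosure (L : signature) (f : nary_term L 1) (Y K : algebra L -> Prop) :
    algebra L -> Prop :=
  fun A => Y A /\ exists (S : set A) (hS : subuniverse S),
    K (subalgebra hS) /\ f_subalgebra f hS.

Record Xif (LX LY : signature) (X : quasivariety LX) (Y : quasivariety LY)
    (V : var_set) (T : selective_translation X Y V) := MkXif {
  xif_class :> algebra LY -> Prop;
  xifP : exists K : Xi Y, xif_class = upclosure (sel T) Y K }.

Section XifLattice.
Variables (LX LY : signature) (X : quasivariety LX) (Y : quasivariety LY).
Variables (V : var_set) (T : selective_translation X Y V).

HB.instance Definition _ := gen_eqMixin (Xif T).
HB.instance Definition _ := gen_choiceMixin (Xif T).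

Lemma xif_ext (K M : Xif T) : (K : set _) = (M : set _) -> K = M.
Proof.
by case: K M => [K K1] [M M1] /= KM; case: _ / KM in M1 *; congr MkXif.
Qed.

Lemma xif_sub (K : Xif T) : K `<=` Y.
Proof. by have [K' ->] := xifP K; move=> A []. Qed.

Definition xif_le (K M : Xif T) : bool := `[< K `<=` M >].

Lemma xif_le_refl : reflexive xif_le.
Proof. by move=> K; apply/asboolP. Qed.

Lemma xif_le_anti : antisymmetric xif_le.
Proof. by move=> K M /andP[/asboolP KM /asboolP MK]; apply/xif_ext/seteqP. Qed.

Lemma xif_le_trans : transitive xif_le.
Proof. by move=> M K N /asboolP KM /asboolP MN; apply/asboolP => A /KM/MN. Qed.

HB.instance Definition _ :=
  Order.Le_isPOrder.Build inclusion_display (Xif T)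
    xif_le_refl xif_le_anti xif_le_trans.

Lemma f_subalgebraP (A : algebra LY) (S : set A) (hS : subuniverse S) :
  f_subalgebra (sel T) hS <-> fixed (sel T) A `<=` S.
Proof.
pose i : hom (subalgebra hS) A :=
  @MkHom LY (subalgebra hS) A (@sval A S) (fun g x => erefl).
have iE (b : subalgebra hS) : fixed (sel T) (subalgebra hS) b <->
    fixed (sel T) A (sval b).
  split=> [/(fixed_hom i)//|bf].
  have iI : injective i by move=> [a ha] [c hc] /= ac; apply: eq_exist.
  by apply: iI; rewrite /sel_op eval_hom.
split=> [<- _ [[b hb] _ <-]//|AS]; apply/seteqP; split=> [_ [b /iE bf <-]//|a af].
by exists (exist _ a (AS a af)) => //; apply/iE.
Qed.

Definition xif_inf_class (P : set (Xif T)) : algebra LY -> Prop :=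
  fun A => Y A /\ forall K : Xif T, P K -> K A.

Lemma xif_infP (P : set (Xif T)) :
  exists K : Xi Y, xif_inf_class P = upclosure (sel T) Y K.
Proof.
pose Q : set (Xi Y) :=
  [set N | exists2 M : Xif T, P M & (M : set _) = upclosure (sel T) Y N].
exists (xi_inf Q); apply/seteqP; split=> A.
  move=> [YA PA]; split => //.
  pose R : set (set A) := [set S | exists (hS : subuniverse S) (N : Xi Y),
    [/\ Q N, N (subalgebra hS) & f_subalgebra (sel T) hS]].
  pose S0 : set A := [set a | forall S, R S -> S a].
  have fS0 : fixed (sel T) A `<=` S0.
    by move=> a af S [hS [N [_ _ /f_subalgebraP]]]; apply.
  have hS0 : subuniverse S0.
    split.
      have [a] := carrier_inhabited A; exists (sel_op (sel T) a).
      by apply: fS0; exact: fixed_sel_op.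
    move=> g x xS0 S RS; have [hS _] := RS.
    by apply: (subuniverse_op hS) => i; exact: xS0.
  exists S0, hS0; split; last exact/f_subalgebraP.
  split; first exact: (quasi_sub (qclassP Y) hS0 YA).
  move=> N QN; have [M PM MN] := QN.
  have := PA M PM; rewrite -[xif_class M A]/((M : set _) A) MN.
  move=> [_ [S [hS [NS fS]]]].
  have S0S : S0 `<=` S by move=> a; apply; exists hS, N.
  pose i : hom (subalgebra hS0) (subalgebra hS) :=
    @MkHom LY (subalgebra hS0) (subalgebra hS)
      (fun a => exist _ (sval a) (S0S _ (svalP a)))
      (fun g x => eq_exist _ _ erefl).
  apply: (quasi_inj (h := i) (xi_quasi N)) NS.
  by move=> [a ha] [b hb] /(congr1 sval)/= ab; apply: eq_exist.
move=> [YA [S [hS [[_ QS] fS]]]]; split => // M PM.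
have [N MN] := xifP M; rewrite MN; split => //.
by exists S, hS; split => //; apply: QS; exists M.
Qed.

Definition xif_inf (P : set (Xif T)) : Xif T := MkXif (xif_infP P).

Definition xif_meet (K M : Xif T) : Xif T := xif_inf [set K; M].
Definition xif_join (K M : Xif T) : Xif T :=
  xif_inf [set N | (K <= N) && (M <= N)].

Lemma xif_meetP (K M N : Xif T) : (K <= xif_meet M N) = (K <= M) && (K <= N).
Proof.
apply/idP/andP => [/asboolP KMN|[/asboolP KM /asboolP KN]].
  by split; apply/asboolP => A /KMN[_]; apply; [left|right].
apply/asboolP => A KA; split; first exact: xif_sub KA.
by move=> _ [->|->]; [exact: KM|exact: KN].
Qed.

Lemma xif_joinP (K M N : Xif T) : (xif_join K M <= N) = (K <= N) && (M <= N).
Proof.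
apply/idP/idP => [/asboolP KMN|KMN]; last by apply/asboolP => A [_]; apply.
apply/andP; split; apply/asboolP => A HA; apply: KMN; split;
  try exact: xif_sub HA.
  by move=> J /andP[/asboolP KJ _]; exact: KJ.
by move=> J /andP[_ /asboolP MJ]; exact: MJ.
Qed.

HB.instance Definition _ := Order.POrder_MeetJoin_isLattice.Build
  inclusion_display (Xif T) xif_meetP xif_joinP.

Definition tau_class (K : algebra LX -> Prop) : algebra LY -> Prop :=
  fun A => exists hA : Y A, K (sval (theta T (exist _ A hA))).

End XifLattice.

(* Main.v *)
Require Import Defs.
From mathcomp Require Import all_boot all_order.
From HB Require Import structures.
From mathcomp Require Import boolp classical_sets filter.

Set Implicit Arguments.
Unset Strict Implicit.
Unset Printing Implicit Defensive.

Import Order.TTheory.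
Local Open Scope classical_set_scope.
Local Open Scope order_scope.

(** The class [tau K] is a quasivariety because [theta] preserves embeddings and
    commutes with reduced products ([theta_rprod]).  Call an element selected if
    the selector fixes it.  The class [tau K] is its own upclosure: if an
    embedding [h : B -> A] has all selected elements of [A] in its range, then
    [theta h] is bijective ([theta_mor_bij]).  So [tau] is well defined, and it
    is clearly monotone.

    It reflects inclusions as the unit is an isomorphism: for [A] in [K] the
    algebra [theta (F A)] is isomorphic to [A], so [F A] is in [tau K]; if
    [tau K] is included in [tau M] then [theta (F A)], hence [A], is in [M]
    ([tau_mono]).

    For surjectivity, given a subquasivariety [N] of [Y], let [M] be the class
    of algebras that embed in [theta B] for some [B] in [N]; it is a
    subquasivariety of [X].  If [theta A] embeds in [theta B] with [B] in [N],
    then sobriety gives embeddings [F (theta A) -> F (theta B) -> B], so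
    [F (theta A)] is in [N]; the counit embeds it in [A], and by a triangle
    identity its range contains the selected elements of [A].  Hence [A] is in
    the upclosure of [N].  The converse inclusion is [theta_mor_bij] again, so
    [tau M] is the upclosure of [N] ([tau_surj]).

    Finally a surjective order embedding of lattices is a lattice morphism. *)

(** * Bijections and lattice morphisms *)

Lemma sval_inj (U : Type) (P : U -> Prop) : injective (@sval U P).
Proof. by move=> [a ha] [b hb] /= ab; apply: eq_exist. Qed.

Lemma inj_surj_bij (U W : Type) (h : U -> W) :
  injective h -> (forall w, exists u, h u = w) -> bijective h.
Proof. by move=> hI /choice[k hK]; exists k => // u; apply: hI; rewrite hK. Qed.

Lemma surj_mono_lmorphism (d d' : Order.disp_t) (U : latticeType d)
    (W : latticeType d') (h : U -> W) :
  {mono h : x y / x <= y} -> (forall w, exists u, h u = w) ->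
  exists m : {lmorphism U -> W}, m =1 h.
Proof.
move=> hM /choice[k hK].
have hI : Order.meet_morphism h.
  move=> x y; apply/eqP; rewrite eq_le lexI !hM leIl leIr /=.
  by rewrite -[h x `&` h y]hK hM lexI -!(hM (k _)) hK leIl leIr.
have hU : Order.join_morphism h.
  move=> x y; apply/eqP; rewrite eq_le leUx !hM leUl leUr /= andbT.
  by rewrite -[h x `|` h y]hK hM leUx -!(hM _ (k _)) hK leUl leUr.
have hO : {homo h : x y / x <= y} by move=> x y; rewrite hM.
pose hO_ := Order.isOrderMorphism.Build d U d' W h hO.
pose hI_ := Order.isMeetLatticeMorphism.Build d U d' W h hI.
pose hU_ := Order.isJoinLatticeMorphism.Build d U d' W h hU.
pose m : {lmorphism U -> W} := HB.pack h hO_ hI_ hU_.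
by exists m.
Qed.

(** * Embeddings and reduced products *)

Section Embeddings.
Variable L : signature.
Implicit Types A B C : algebra L.

Lemma isomorphic_sym A B : isomorphic A B -> isomorphic B A.
Proof.
move=> [h [k hK kK]].
have kop (g : sym L) (x : fin (arity g) -> B) : k (op g x) = op g (fun i => k (x i)).
  apply: (can_inj hK); rewrite kK hom_op; congr op.
  by apply/funext => i; rewrite kK.
by exists (MkHom kop), h.
Qed.

Lemma range_subuniverse A B (h : hom A B) : subuniverse (range h).
Proof.
split; first by have [a] := carrier_inhabited A; exists (h a), a.
move=> g x xh; have {}xh i : exists a, h a = x i by have [a _] := xh i; exists a.
have [y yP] := choice xh.
by exists (op g y) => //; rewrite hom_op; congr op; apply/funext.
Qed.

(** An embedding corestricts to an isomorphism onto its range. *)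
Lemma range_isomorphic A B (h : hom A B) : injective h ->
  isomorphic A (subalgebra (range_subuniverse h)).
Proof.
move=> hI.
pose k (a : A) : subalgebra (range_subuniverse h) := exist _ (h a) (imageT h a).
have kop (g : sym L) (x : fin (arity g) -> A) : k (op g x) = op g (fun i => k (x i)).
  by apply: eq_exist => /=; rewrite hom_op.
exists (MkHom kop); apply: inj_surj_bij => [a b /(congr1 sval)/hI //|].
by move=> [b hb]; have [a _ hab] := hb; exists a; apply: eq_exist.
Qed.

(** The inclusion of a subalgebra, as a homomorphism. *)
Definition subalgebra_incl A (S : set A) (hS : subuniverse S) :
    hom (subalgebra hS) A :=
  @MkHom L (subalgebra hS) A (@sval A S) (fun g x => erefl).

Lemma subalgebra_incl_inj A (S : set A) (hS : subuniverse S) :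
  injective (subalgebra_incl hS).
Proof. exact: sval_inj. Qed.

Section ReducedProduct.
Variables (I : Type) (F : set_system I) (FF : Filter F).

Lemma eval_rprod (V : Type) (A : I -> algebra L) (v : V -> forall i, A i)
    (t : term L V) :
  @eval L V (reduced_product F A) (fun x => rprod_proj F (v x)) t =
  rprod_proj F (fun i => eval (fun x => v x i) t).
Proof.
elim: t => //= g ts IH; rewrite -[RHS](rprod_op_proj FF).
by congr (@op L (reduced_product F A)); apply/funext.
Qed.

Lemma rprod_embedding (A B : I -> algebra L) (h : forall i, hom (A i) (B i)) :
  (forall i, injective (h i)) ->
  exists k : hom (reduced_product F A) (reduced_product F B), injective k.
Proof.
move=> hI.
pose k (x : reduced_product F A) : reduced_product F B :=
  rprod_proj F (fun i => h i (rprod_repr x i)).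
have kE a : k (rprod_proj F a) = rprod_proj F (fun i => h i (a i)).
  apply/(rprod_projE FF); have /(rprod_projE FF) := rprod_reprK (rprod_proj F a).
  by apply: filterS => i /= ->.
have kop (g : sym L) (x : fin (arity g) -> reduced_product F A) :
    k (op g x) = op g (fun i => k (x i)).
  rewrite [op g x]/(rprod_op x) /rprod_op kE /k rprod_op_proj; congr rprod_proj.
  by apply/functional_extensionality_dep => i; rewrite hom_op.
exists (MkHom kop) => x y /=.
rewrite -(rprod_reprK x) -(rprod_reprK y) !kE.
move=> /(rprod_projE FF) xy; apply/(rprod_projE FF).
by apply: filterS xy => i /= /hI.
Qed.

End ReducedProduct.
End Embeddings.

(** * The functor theta on embeddings and reduced products *)

Section ThetaEmbeddings.
Variables (LX LY : signature) (X : quasivariety LX) (Y : quasivariety LY).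
Variables (V : var_set) (T : selective_translation X Y V).
Local Notation f := (sel T).

Lemma qcat_iso_inj (L : signature) (K : quasivariety L) (A B : qcat K)
    (h : mor A B) : is_iso h -> injective h.
Proof.
move=> [k [kh _]] a b hab.
by rewrite -[a]/(idm A a) -[b]/(idm A b) -kh /= hab.
Qed.

Lemma theta_mor_inj (A B : qcat Y) (h : mor A B) :
  injective h -> injective (theta_mor T h).
Proof. by move=> hI a b /(congr1 sval)/hI/sval_inj. Qed.

(** Selected elements of [B] that are in the range of an embedding come from
    selected elements, since the embedding reflects [f(a) = a]. *)
Lemma theta_mor_bij (A B : qcat Y) (h : mor A B) :
  injective h -> fixed f (sval B) `<=` range h -> bijective (theta_mor T h).
Proof.
move=> hI fB; apply: inj_surj_bij (theta_mor_inj hI) _.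
move=> [b bf]; have [a _ hab] := fB b bf.
suff af : fixed f (sval A) a by exists (exist _ a af); apply: eq_exist.
by apply: hI; rewrite /sel_op eval_hom; rewrite -hab in bf.
Qed.

(** [theta] commutes with reduced products.  The isomorphism sends the class of
    a family of selected elements to the class of the same family in the reduced
    product of the [A i].  It is surjective: a class [x] with [f(x) = x] is also
    the class of [f] applied coordinatewise to any of its representatives, and
    all coordinates of that family are selected. *)
Lemma theta_rprod (I : Type) (F : set_system I) (FF : Filter F)
    (A : I -> qcat Y) (hA : Y (reduced_product F (fun i => sval (A i)))) :
  isomorphic (reduced_product F (fun i => sval (theta T (A i))))
    (sval (theta T (exist _ _ hA))).
Proof.
set P := reduced_product F (fun i => sval (theta T (A i))).
set R := reduced_product F (fun i => sval (A i)).
have projf (a : forall i, sval (theta T (A i))) :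
    fixed f R (rprod_proj F (fun i => sval (a i))).
  rewrite /fixed /sel_op /= eval_rprod; congr rprod_proj.
  by apply/functional_extensionality_dep => i; exact: (svalP (a i)).
pose k (x : P) : sval (theta T (exist _ R hA)) :=
  exist _ _ (projf (rprod_repr x)).
have kE a : sval (k (rprod_proj F a)) = rprod_proj F (fun i => sval (a i)).
  apply/(rprod_projE FF); have /(rprod_projE FF) := rprod_reprK (rprod_proj F a).
  by apply: filterS => i /= ->.
have kop (g : sym LX) (x : fin (arity g) -> P) :
    k (op g x) = op g (fun i => k (x i)).
  apply: eq_exist.
  transitivity (rprod_proj F (fun i => sval (op g (fun j => rprod_repr (x j) i)))).
    exact: kE.
  by rewrite /= eval_rprod.
exists (MkHom kop); apply: inj_surj_bij => /=.
  move=> x y; rewrite -(rprod_reprK x) -(rprod_reprK y) => /(congr1 sval).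
  rewrite !kE => /(rprod_projE FF) xy; apply/(rprod_projE FF).
  by apply: filterS xy => i /= xy; apply: sval_inj.
move=> [x xf].
pose a i : sval (theta T (A i)) :=
  exist _ _ (fixed_sel_op T (rprod_repr x i) (svalP (A i))).
exists (rprod_proj F a); apply: sval_inj; rewrite [LHS]kE -[RHS]xf.
by rewrite -(rprod_reprK x) /sel_op eval_rprod.
Qed.

(** * The class tau K is an f-quasivariety *)

(** Membership in the upclosure, with subalgebras replaced by embeddings. *)
Lemma upclosureP (K : Xi Y) (A : qcat Y) :
  upclosure f Y K (sval A) <->
  exists (B : qcat Y) (h : mor B A),
    [/\ K (sval B), injective h & fixed f (sval A) `<=` range h].
Proof.
split=> [[_ [S [hS [KS /f_subalgebraP fS]]]]|[B [h [KB hI fh]]]].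
  exists (exist _ (subalgebra hS) (xi_sub KS)), (subalgebra_incl hS).
  split=> // [|a /fS aS]; first exact: subalgebra_incl_inj.
  by exists (exist _ a aS).
split; first exact: svalP.
exists (range h), (range_subuniverse h); split; last exact/f_subalgebraP.
exact: (quasi_iso (xi_quasi K) (range_isomorphic hI) KB).
Qed.

(** [tau_class] does not depend on the proof that the algebra belongs to [Y]. *)
Lemma tau_classE (K : algebra LX -> Prop) (A : qcat Y) :
  tau_class T K (sval A) <-> K (sval (theta T A)).
Proof.
case: A => A hA; split=> [[hA' KA]|KA]; last by exists hA.
by rewrite (Prop_irrelevance hA hA').
Qed.

Lemma tau_class_quasi (K : Xi X) : is_quasivariety (tau_class T K).
Proof.
split.
- move=> A B /isomorphic_sym[h hB] [hA KA].
  have YB : Y B := quasi_inj (qclassP Y) (bij_inj hB) hA.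
  exists YB.
  apply: (quasi_inj (xi_quasi K) _ KA).
  exact: (@theta_mor_inj (exist _ B YB) (exist _ A hA) h (bij_inj hB)).
- move=> A S hS [hA KA].
  have YS := quasi_sub (qclassP Y) hS hA.
  exists YS; apply: (quasi_inj (xi_quasi K) _ KA).
  apply: (@theta_mor_inj (exist _ _ YS) (exist _ A hA)).
  exact: (@subalgebra_incl_inj _ _ _ hS).
- move=> I F A FF tA.
  have hA i : Y (A i) by have [] := tA i.
  pose A' i : qcat Y := exist _ (A i) (hA i).
  have hP : Y (reduced_product F A) := quasi_rprod (qclassP Y) FF hA.
  exists hP.
  apply: (quasi_iso (xi_quasi K) (theta_rprod (A := A') FF hP)).
  by apply: (quasi_rprod (xi_quasi K) FF) => i; exact/(tau_classE K (A' i))/tA.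
Qed.

Lemma tau_class_sub (K : Xi X) : tau_class T K `<=` Y.
Proof. by move=> A []. Qed.

Lemma tau_class_upclosure (K : Xi X) :
  tau_class T K = upclosure f Y (MkXi (tau_class_quasi K) (@tau_class_sub K)).
Proof.
apply/seteqP; split=> A.
  move=> tA; have [hA _] := tA.
  apply/(upclosureP _ (exist _ A hA)).
  exists (exist _ A hA), (hom_id A); split=> [||a _]; [exact: tA|by []|by exists a].
move=> uA; have [hA _] := uA.
have /(upclosureP _ (exist _ A hA))[B [h [tB hI fh]]] := uA.
apply/(tau_classE K (exist _ A hA)).
apply: (quasi_iso (xi_quasi K) _ (proj1 (tau_classE K B) tB)).
by exists (theta_mor T h); exact: theta_mor_bij.
Qed.

(** The map of the theorem, as a map of underlying sets. *)
Definition tau (K : Xi X) : Xif T :=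
  MkXif (ex_intro _ _ (tau_class_upclosure K)).

(** * The map tau is a surjective order embedding *)

Lemma tau_mono (F : left_adjoint (theta T)) :
  strongly_selective F -> {mono tau : K M / K <= M}.
Proof.
move=> etaI K M; apply/asboolP/asboolP => KM A; last first.
  by move=> [hA /KM MA]; exists hA.
move=> KA; pose A' : qcat X := exist _ A (xi_sub KA).
have [k [ku uk]] := etaI A'.
apply: (quasi_inj (h := unit F A') (xi_quasi M)).
  exact: qcat_iso_inj (etaI A').
apply/tau_classE; apply: KM; apply/tau_classE.
apply: (quasi_inj (h := k) (xi_quasi K) _ KA).
by apply: (@qcat_iso_inj _ _ _ _ k); exists (unit F A').
Qed.

(** The class of the algebras that embed in [theta B] for some [B] in [N]. *)
Definition theta_embedded (N : Xi Y) : algebra LX -> Prop :=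
  fun C => exists2 B : qcat Y, N (sval B) &
    exists h : hom C (sval (theta T B)), injective h.

Lemma theta_embedded_inj (N : Xi Y) (C D : algebra LX) (h : hom C D) :
  injective h -> theta_embedded N D -> theta_embedded N C.
Proof.
move=> hI [B NB [k kI]]; exists B => //; exists (hom_comp k h).
by move=> a b /kI/hI.
Qed.

Lemma theta_embedded_quasi (N : Xi Y) : is_quasivariety (theta_embedded N).
Proof.
split.
- move=> C D /isomorphic_sym[h /bij_inj hI]; exact: theta_embedded_inj hI.
- by move=> C S hS; exact/theta_embedded_inj/subalgebra_incl_inj.
- move=> I F C FF tC.
  have /choice[B BP] : forall i, exists B : qcat Y, N (sval B) /\
      exists h : hom (C i) (sval (theta T B)), injective h.
    by move=> i; have [B NB Bh] := tC i; exists B.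
  pose h i := sval (cid (BP i).2).
  have hI i : injective (h i) by exact: svalP (cid (BP i).2).
  have NR : N (reduced_product F (fun i => sval (B i))).
    by apply: (quasi_rprod (xi_quasi N) FF) => i; have [] := BP i.
  have [k kI] := rprod_embedding FF hI.
  have [w /bij_inj wI] := theta_rprod FF (xi_sub NR).
  by exists (exist _ _ (xi_sub NR)) => //; exists (hom_comp w k) => a b /wI/kI.
Qed.

Lemma theta_embedded_sub (N : Xi Y) : theta_embedded N `<=` X.
Proof.
by move=> C [B _ [h hI]]; exact: quasi_inj (qclassP X) hI (svalP (theta T B)).
Qed.

(** By a triangle identity, a selected element [a] is the image under the
    counit of its image under the unit. *)
Lemma counit_range (F : left_adjoint (theta T)) (A : qcat Y) :
  fixed f (sval A) `<=` range (counit F A : hom _ _).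
Proof.
pose A' := sval (theta T A).
move=> a af; pose a' : A' := exist _ a af.
have /(congr1 (fun h : hom A' A' => sval (h a'))) /= aE := triangle_right F A.
by exists (sval ((unit F (theta T A) : hom _ _) a')).
Qed.

Lemma tau_surj (hT : sober T) (M : Xif T) : exists K : Xi X, tau K = M.
Proof.
have [F [_ epsI FI]] := hT; have [N MN] := xifP M.
exists (MkXi (theta_embedded_quasi N) (@theta_embedded_sub N)).
apply: xif_ext; rewrite MN; apply/seteqP; split=> A.
  move=> tA; have [hA _] := tA; pose A' : qcat Y := exist _ A hA.
  have /(tau_classE _ A')[B NB [h hI]] := tA.
  apply/(upclosureP _ A').
  exists (ladj F (theta T A')), (counit F A'); split.
  - (* [F (theta A)] embeds in [B], through [F (theta B)]. *)
    pose h' : mor (theta T A') (theta T B) := h.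
    pose k : mor (ladj F (theta T A')) B := cmp (counit F B) (Defs.fmap F h').
    have kI : injective (k : hom _ _) by move=> a b /epsI/(FI _ _ h' hI).
    exact: quasi_inj (xi_quasi N) kI NB.
  - exact: epsI.
  - exact: counit_range.
move=> uA; have [hA _] := uA; pose A' : qcat Y := exist _ A hA.
have /(upclosureP _ A')[B [h [NB hI fh]]] := uA.
apply/(tau_classE _ A'); exists B => //.
have [k /bij_inj kI] : isomorphic (sval (theta T A')) (sval (theta T B)).
  by apply: isomorphic_sym; exists (theta_mor T h); exact: theta_mor_bij.
by exists k.
Qed.
End ThetaEmbeddings.

Theorem proposition6p14 (LX LY : signature)
    (X : quasivariety LX) (Y : quasivariety LY) (V : var_set)
    (T : selective_translation X Y V) (hT : sober T) :
  exists tau : {lmorphism Xi X -> Xif T},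
    bijective tau /\
    forall K : Xi X, xif_class (tau K) = tau_class T K.
Proof.
have [F [etaI _ _]] := hT.
have tauM := tau_mono etaI; have tauS := tau_surj hT.
have [m mE] := surj_mono_lmorphism tauM tauS.
exists m; split; last by move=> K; rewrite mE.
apply: (eq_bij _ (fsym mE)); apply: inj_surj_bij tauS.
by apply: inc_inj => K M; exact: tauM.
Qed.
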